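(* Let $G$ be a group and let $\phi$ be a first-order formula in the group language over $G$, with free variables $x_1,\dots,x_n$. If the rank of the matrix $A(\phi)$ is less than the number $n$ of free variables of $\phi$, then the number of tuples $(g_1,\dots,g_n)\in G^n$ satisfying $\phi$ is divisible by the order of the centraliser in $G$ of the set of all non-isolated coefficients of $\phi$. In particular, this number is divisible by $|G|$ if all non-isolated coefficients of $\phi$ equal $1$.
   Context: The group $G$ need not be finite. Divisibility is understood in the sense of cardinal arithmetic: any infinite cardinal is divisible by any smaller or equal nonzero cardinal, and zero is divisible by any cardinal. Group language over $G$: it has two functional symbols $\cdot$ and $^{-1}$ and a constant symbol for each element $g\in G$; formulae are interpreted in $G$ (quantifiers range over $G$, constants are interpreted by the corresponding elements). Formulae need not be in prenex form. Free and bound variables are different symbols. Each atomic subformula of $\phi$ can be written as $u=1$ with $u\in G*F$, where $F$ is the free group generated by all (free and bound) variables of $\phi$. The elements of $G$ occurring in these words are called the coefficients of $\phi$. Digraph $\Gamma(\phi)$: its vertices are all bound variables of $\phi$. Each atomic subformula containing bound variables is written (left-hand sides being considered as cyclic words) in the form $$v_1(y_1)w_1(x_1,\dots,x_n)\cdots v_r(y_r)w_r(x_1,\dots,x_n)=h,$$ where the $y_i$ are bound variables (not necessarily different), $x_1,\dots,x_n$ are all the (different) free variables of $\phi$, $v_i(y_i)\in G*\langle y_i\rangle_\infty$ (the free product of $G$ and the infinite cyclic group generated by the letter $y_i$; $y_i$ really occurs in $v_i$), $w_i\in G*F(x_1,\dots,x_n)$ (free product of $G$ and the free group with basis $x_1,\dots,x_n$),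 and $h\in G$. For each such atomic subformula and each $i$ (subscripts modulo $r$), draw a directed edge from $y_i$ to $y_{i+1}$ labelled by the integer tuple $(\alpha_1,\dots,\alpha_n)$, where $\alpha_j$ is the exponent sum of $x_j$ in $w_i$; loops labelled by zero tuples are excluded. Matrix $A(\phi)$: choose cycles $c_1,c_2,\dots$ in $\Gamma(\phi)$ generating its first homology group (of the underlying undirected graph). For each $c_i$ write a row which is the sum of the labels of the edges of $c_i$, taken with sign plus or minus depending on orientation. Then, for each atomic subformula $u(x_1,\dots,x_n)=1$ containing no bound variables, add the row consisting of the exponent sums of $x_1,\dots,x_n$ in $u$. The integer linear hull of the rows (hence the rank) does not depend on the choice of the cycles. The matrix has $n$ columns. A bound variable $t$ is isolating if it occurs in atomic subformulae only in subwords of the form $t^{-1}gt$ with $g\in G$ (various $g$ allowed). A coefficient $g\in G$ of $\phi$ is isolated if it occurs in $\phi$ only in subwords of the form $t^{-1}gt$ where $t$ is an isolating variable (various isolating $t$ allowed); otherwise it is non-isolated. *)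

(* Defs.v *)
From HB Require Import structures.
From mathcomp Require Import all_boot all_order all_algebra.
From mathcomp Require Import boolp classical_sets functions cardinality.
From Stdlib Require List.

Set Implicit Arguments.
Unset Strict Implicit.
Unset Printing Implicit Defensive.

Import GRing.Theory.

(* inl i is the free variable x_i and inr y is the bound variable y, so that
   free and bound variables are different symbols. *)
Definition var (n : nat) : Type := ('I_n + nat)%type.

Definition is_bound_var n (v : var n) : bool := if v is inr _ then true else false.

Inductive term (G : Type) (n : nat) : Type :=
| Const of G
| Var of var n
| Mul of term G n & term G n
| Inv of term G n.

Arguments Const {G n} _.
Arguments Var {G n} _.

Inductive formula (G : Type) (n : nat) : Type :=
| Eq of term G n & term G n
| Not of formula G n
| And of formula G n & formula G n
| Or of formula G n & formula G n
| Imp of formula G n & formula G n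
| All of nat & formula G n
| Ex of nat & formula G n.

Fixpoint term_vars G n (t : term G n) : seq ('I_n + nat) :=
  match t with
  | Const _ => [::]
  | Var v => [:: v]
  | Mul s t => term_vars s ++ term_vars t
  | Inv t => term_vars t
  end.

(* The variables having an occurrence which is not in the scope of a
   corresponding quantifier. *)
Fixpoint unquantified G n (phi : formula G n) : seq ('I_n + nat) :=
  match phi with
  | Eq s t => term_vars s ++ term_vars t
  | Not p => unquantified p
  | And p q | Or p q | Imp p q => unquantified p ++ unquantified q
  | All y p | Ex y p => [seq v <- unquantified p | v != inr y]
  end.

Definition has_free_vars G n (phi : formula G n) : Prop :=
  forall v : 'I_n + nat, (v \in unquantified phi) = ~~ is_bound_var v.

Section Semantics.
Local Open Scope group_scope.
Variables (G : groupType) (n : nat).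

Fixpoint eval (v : 'I_n + nat -> G) (t : term G n) : G :=
  match t with
  | Const g => g
  | Var x => v x
  | Mul s t => eval v s * eval v t
  | Inv t => (eval v t)^-1
  end.

Definition update (v : 'I_n + nat -> G) (y : nat) (g : G) : 'I_n + nat -> G :=
  fun x => if x == inr y then g else v x.

Fixpoint holds (v : 'I_n + nat -> G) (phi : formula G n) : Prop :=
  match phi with
  | Eq s t => eval v s = eval v t
  | Not p => ~ holds v p
  | And p q => holds v p /\ holds v q
  | Or p q => holds v p \/ holds v q
  | Imp p q => holds v p -> holds v q
  | All y p => forall g : G, holds (update v y g) p
  | Ex y p => exists g : G, holds (update v y g) p
  end.

(* The value 1 given to the bound variables is a dummy: it is never read when
   all bound variables are quantified. *)
Definition valuation (x : n.-tuple G) (v : 'I_n + nat) : G :=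
  match v with inl i => tnth x i | inr _ => 1 end.

Definition solutions (phi : formula G n) : set (n.-tuple G) :=
  [set x : n.-tuple G | holds (valuation x) phi]%classic.

Definition centraliser (S : set G) : set G :=
  [set g : G | forall c : G, S c -> g * c = c * g]%classic.

End Semantics.

(* |A| divides |B| in cardinal arithmetic: |B| = |A| k for some cardinal k.
   Thus 0 is divisible by every cardinal and an infinite cardinal is divisible
   by every nonzero cardinal not exceeding it. *)
Definition card_divides (T U : Type) (A : set T) (B : set U) : Prop :=
  exists (K : Type) (C : set K), ((A `*` C)%classic #= B)%card.

(* Words representing the elements of the free product G * F, where F is the
   free group on the variables; Lvar v true stands for v^-1. *)
Inductive letter (G : Type) (n : nat) : Type :=
| Lcst of G
| Lvar of var n & bool.

Arguments Lcst {G n} _.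
Arguments Lvar {G n} _ _.

Definition word (G : Type) (n : nat) : Type := seq (letter G n).

Definition is_bound G n (l : letter G n) : bool :=
  if l is Lvar v _ then is_bound_var v else false.

Section Words.
Local Open Scope group_scope.
Variables (G : groupType) (n : nat).

Definition inv_letter (l : letter G n) : letter G n :=
  match l with Lcst g => Lcst g^-1 | Lvar v e => Lvar v (~~ e) end.

Definition inv_word (w : word G n) : word G n := rev (map inv_letter w).

Fixpoint term_word (t : term G n) : word G n :=
  match t with
  | Const g => [:: Lcst g]
  | Var v => [:: Lvar v false]
  | Mul s t => term_word s ++ term_word t
  | Inv t => inv_word (term_word t)
  end.

(* One word s t^-1 for each atomic subformula s = t. *)
Fixpoint atoms (phi : formula G n) : seq (word G n) :=
  match phi with
  | Eq s t => [:: term_word s ++ inv_word (term_word t)]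
  | Not p => atoms p
  | And p q | Or p q | Imp p q => atoms p ++ atoms q
  | All _ p | Ex _ p => atoms p
  end.

(* Equality of the elements of G * F represented by two words. *)
Inductive free_prod_eq : word G n -> word G n -> Prop :=
| fp_refl u : free_prod_eq u u
| fp_sym u w : free_prod_eq u w -> free_prod_eq w u
| fp_trans u v w : free_prod_eq u v -> free_prod_eq v w -> free_prod_eq u w
| fp_mul p s g h :
    free_prod_eq (p ++ [:: Lcst g; Lcst h] ++ s) (p ++ [:: Lcst (g * h)] ++ s)
| fp_one p s : free_prod_eq (p ++ [:: Lcst 1] ++ s) (p ++ s)
| fp_cancel p s v e :
    free_prod_eq (p ++ [:: Lvar v e; Lvar v (~~ e)] ++ s) (p ++ s).

(* The equation u = 1 may be written as w = 1: as a cyclic word, w represents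
   the same element as u. *)
Definition can_be_written (u w : word G n) : Prop :=
  exists p q : word G n, free_prod_eq u (p ++ q) /\ w = q ++ p.

(* ws is a way of writing all the atomic subformulae of phi in the form w = 1;
   the words in ws need not be reduced. *)
Definition writing (phi : formula G n) (ws : seq (word G n)) : Prop :=
  List.Forall2 can_be_written (atoms phi) ws.

End Words.

Section Coefficients.
Variables (G : Type) (n : nat) (ws : seq (word G n)).
Implicit Types (w p s : word G n) (t : nat) (g : G).

Definition coefficient g : Prop :=
  exists w p s, List.In w ws /\ w = p ++ Lcst g :: s.

Definition isolating t : Prop :=
  forall w p s, List.In w ws ->
    (w = p ++ Lvar (inr t) true :: s ->
       exists g s', s = [:: Lcst g, Lvar (inr t) false & s']) /\
    (w = p ++ Lvar (inr t) false :: s ->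
       exists g p', p = p' ++ [:: Lvar (inr t) true; Lcst g]).

Definition isolated g : Prop :=
  coefficient g /\
  forall w p s, List.In w ws -> w = p ++ Lcst g :: s ->
    exists t p' s', [/\ isolating t, p = p' ++ [:: Lvar (inr t) true]
                      & s = Lvar (inr t) false :: s'].

Definition non_isolated : set G :=
  [set g | coefficient g /\ ~ isolated g]%classic.

End Coefficients.

Local Open Scope ring_scope.

Definition letter_exponents G n (l : letter G n) : 'rV[int]_n :=
  match l with
  | Lvar (inl i) e => (-1) ^+ e *: delta_mx 0 i
  | _ => 0
  end.

Definition exponents G n (w : word G n) : 'rV[int]_n :=
  \sum_(l <- w) letter_exponents l.

(* (y, z, a) is an edge from y to z labelled by a. *)
Definition edge (n : nat) : Type := (nat * nat * 'rV[int]_n)%type.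

Definition esrc n (e : edge n) : nat := e.1.1.
Definition etgt n (e : edge n) : nat := e.1.2.
Definition elab n (e : edge n) : 'rV[int]_n := e.2.

(* The edges coming from the remaining part w of a cyclic word which starts
   with the bound variable first, when the last bound variable read is cur and
   a is the exponent vector of what has been read after it. *)
Fixpoint edges_from G n (first cur : nat) (a : 'rV[int]_n) (w : word G n)
    : seq (edge n) :=
  match w with
  | [::] => [:: (cur, first, a)]
  | Lvar (inr y) _ :: w' => (cur, y, a) :: edges_from first y 0 w'
  | l :: w' => edges_from first cur (a + letter_exponents l) w'
  end.

(* One edge for each pair of cyclically consecutive occurrences of bound
   variables. Two occurrences of y inside the same syllable v_i(y) only give a
   loop with zero label, and such loops are not in the digraph anyway. *)
Definition word_edges G n (w : word G n) : seq (edge n) :=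
  if rot (find (@is_bound G n) w) w is Lvar (inr y) _ :: w'
  then edges_from y y 0 w' else [::].

(* The edges of the digraph; its vertices are the bound variables. *)
Definition digraph G n (ws : seq (word G n)) : seq (edge n) :=
  [seq e <- flatten (map (@word_edges G n) ws)
     | ~~ ((esrc e == etgt e) && (elab e == 0))].

Section Cycles.
Variables (n : nat) (E : seq (edge n)).

Definition nth_edge (i : 'I_(size E)) : edge n := tnth (in_tuple E) i.

(* An edge of the underlying undirected graph with a direction of travel; it is
   travelled backwards when the boolean is true. *)
Definition dart : Type := ('I_(size E) * bool)%type.

Definition dsrc (d : dart) : nat :=
  if d.2 then etgt (nth_edge d.1) else esrc (nth_edge d.1).
Definition dtgt (d : dart) : nat :=
  if d.2 then esrc (nth_edge d.1) else etgt (nth_edge d.1).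

Definition is_cycle (c : seq dart) : bool :=
  path.cycle (fun d d' => dtgt d == dsrc d') c.

Definition chain (c : seq dart) : 'rV[int]_(size E) :=
  \sum_(d <- c) (-1) ^+ d.2 *: delta_mx 0 d.1.

Definition label_sum (c : seq dart) : 'rV[int]_n :=
  \sum_(d <- c) (-1) ^+ d.2 *: elab (nth_edge d.1).

(* The first homology group of a graph is the kernel of the boundary map on
   1-chains. *)
Definition in_H1 (z : 'rV[int]_(size E)) : Prop :=
  forall y : nat, \sum_(i | etgt (nth_edge i) == y) z 0 i
                = \sum_(i | esrc (nth_edge i) == y) z 0 i.

Definition generating_cycles (cs : seq (seq dart)) : Prop :=
  all is_cycle cs /\
  forall z, in_H1 z -> inIntSpan (in_tuple (map chain cs)) z.

End Cycles.

Definition rowsA G n (ws : seq (word G n)) (cs : seq (seq (dart (digraph ws))))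
    : seq 'rV[int]_n :=
  [seq label_sum c | c <- cs] ++
  [seq exponents w | w <- ws & ~~ has (@is_bound G n) w].

Definition matrixA G n (ws : seq (word G n))
    (cs : seq (seq (dart (digraph ws)))) : 'M[int]_(size (rowsA cs), n) :=
  \matrix_(i < size (rowsA cs)) tnth (in_tuple (rowsA cs)) i.

Definition rankA G n (ws : seq (word G n))
    (cs : seq (seq (dart (digraph ws)))) : nat :=
  \rank (map_mx (fun a : int => a%:~R : rat) (matrixA cs)).

(* Main.v *)
(** A vector f orthogonal to the rows of A(phi) with coprime entries gives the
   free variable x_i the weight f_i. Since the weights of the cycles of the
   digraph vanish, each bound variable y can be put at a level d(y) so that the
   words between consecutive bound variables have as weight the difference of
   the levels. Let H be the centraliser and (c_k), k in Z, a family in H such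
   that y_i := c_k^-1 x_i c_(k + f_i) does not depend on k. Then x satisfies
   phi iff y does: transform a bound variable z at level k into c_k^-1 z c_k,
   or into z c_k if z is isolating, so that each atomic word is conjugated.

   It remains to see that the class of x under these transformations is in
   bijection with H. As the f_i generate Z, a family is determined by its
   source, its target and c_0. The values at 0 of the families from x to x
   form a subgroup C of H. Choose representatives r of the cosets C h and
   write h = g r. The family a from x to x with a_0 = g has partial products
   c_k = a_(k-1) ... a_0, which lead from x to some tuple; its conjugate
   r^-1 (_) r is the element of the class corresponding to h. *)

Require Import Defs.
From HB Require Import structures.
From mathcomp Require Import all_boot all_order all_algebra.
From mathcomp Require Import boolp classical_sets functions cardinality.
From mathcomp Require Import ring.


Set Implicit Arguments.
Unset Strict Implicit.
Unset Printing Implicit Defensive.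

Import GRing.Theory.

(** * Equivalence relations and divisibility of cardinals *)

Definition equiv_rel T (R : T -> T -> Prop) : Prop :=
  [/\ forall x, R x x, forall x y, R x y -> R y x
    & forall x y z, R x y -> R y z -> R x z].

Lemma equiv_rel_repr (T : choiceType) (R : T -> T -> Prop) :
  equiv_rel R ->
  exists rep : T -> T,
    (forall x, R x (rep x)) /\ (forall x y, R x y -> rep x = rep y).
Proof.
move=> [Rxx Rsym Rtrans].
have exR x : exists y, `[< R x y >] by exists x; apply/asboolP.
exists (fun x => xchoose (exR x)); split=> [x|x y Rxy].
  exact/asboolP/(xchooseP (exR x)).
apply: eq_xchoose => z; apply/asboolP/asboolP; last exact: Rtrans.
exact/Rtrans/Rsym.
Qed.

(** The quotient is the number of classes contained in [B], counted by representatives: [F u]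
    parametrises the class of [u] by [A]. *)
Lemma card_divides_equiv (T : Type) (U : choiceType) (A : set T) (B : set U)
    (R : U -> U -> Prop) (F : U -> T -> U) :
  equiv_rel R ->
  (forall u v, R u v -> B u -> B v) ->
  (forall u, {in A &, injective (F u)}) ->
  (forall u, F u @` A = R u)%classic ->
  card_divides A B.
Proof.
move=> Req BR Finj Fim.
have [Rxx Rsym Rtrans] := Req.
have [rep [repP rep_eq]] := equiv_rel_repr Req.
exists U, (rep @` B)%classic.
have RF u a : A a -> R u (F u a).
  by move=> Aa; rewrite -Fim; exists a.
rewrite card_eq_sym.
have {1}-> : B = ((fun p => F p.2 p.1) @` (A `*` (rep @` B)))%classic.
  apply/seteqP; split=> [v Bv|_ [[a _] [/= Aa [u Bu <-]] <-]].
    have : R (rep v) v by apply/Rsym/repP.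
    rewrite -Fim => -[a Aa Fv].
    by exists (a, rep v) => //; split=> //; exists v.
  by apply: (BR u) => //; apply: (Rtrans _ _ _ (repP u)); apply: RF.
apply: inj_card_eq => -[a w] [a' w'] /set_mem[/= Aa [u Bu ew]].
move=> /set_mem[/= Aa' [u' Bu' ew']]; rewrite -{}ew -{}ew' => eqF.
have eq_rep : rep u = rep u'.
  apply: rep_eq; apply: (Rtrans _ _ _ (repP u)); apply: (Rtrans _ _ _ (RF _ _ Aa)).
  by rewrite eqF; apply/Rsym/(Rtrans _ _ _ (repP u'))/RF.
rewrite -eq_rep in eqF *; congr (_, _).
by apply: Finj eqF; apply: mem_set.
Qed.

(** * Induction along shifts of the integers *)

Lemma int_shift_ind (P : int -> Prop) :
  P 0%R -> (forall k, P k <-> P (k + 1)%R) -> forall k, P k.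
Proof.
move=> P0 PS; elim=> // k Pk; first by rewrite -addn1 PoszD; apply: (PS _).1.
by apply: (PS _).2; rewrite -addn1 PoszD opprD subrK.
Qed.

(** The f_i generate Z, so shifts by them and their inverses lead from 0 to every integer. *)
Lemma int_lin_comb_ind n (f b : 'I_n -> int) (P : int -> Prop) :
  (\sum_i b i * f i = 1)%R -> P 0%R ->
  (forall i k, P k <-> P (k + f i)%R) -> forall k, P k.
Proof.
move=> bf P0 Pf.
have Pmul i m k : P k <-> P (k + m * f i)%R.
  move: m; apply: int_shift_ind => [|m]; first by rewrite mul0r addr0.
  by rewrite mulrDl mul1r addrA -Pf.
suff Psum m (s : seq 'I_n) : P (m * \sum_(i <- s) b i * f i)%R.
  by move=> k; have := Psum k (index_enum 'I_n); rewrite bf mulr1.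
elim: s => [|i s IH]; first by rewrite big_nil mulr0.
by rewrite big_cons addrC mulrDr mulrA -Pmul.
Qed.

(** * Gauge transformations and their classes *)

Section Gauge.
Local Open Scope group_scope.
Variables (G : groupType) (n : nat) (H : set G) (f : 'I_n -> int).
Hypothesis H1 : H 1.
Hypothesis HM : forall g h, H g -> H h -> H (g * h).
Hypothesis HV : forall g, H g -> H g^-1.
Implicit Types (a c : int -> G) (x y z : n.-tuple G) (k : int).

(* A tuple x labels the edges k -> k + f i of a graph with vertex set Z by the
   elements x i; a gauge transformation of this labelling is by definition one
   whose result y is again invariant under translations. *)
Definition gauge c x y : Prop :=
  (forall k, H (c k)) /\
  forall i k, c k * tnth y i = tnth x i * c (k + f i)%R.

Lemma gauge_id x : gauge (fun=> 1) x x.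
Proof. by split=> // i k; rewrite mul1g mulg1. Qed.

Lemma gauge_comp c c' x y z :
  gauge c x y -> gauge c' y z -> gauge (fun k => c k * c' k) x z.
Proof.
move=> [Hc cE] [Hc' c'E]; split=> [k|i k]; first exact: HM.
by rewrite -mulgA c'E !mulgA cE.
Qed.

Lemma gauge_inv c x y : gauge c x y -> gauge (fun k => (c k)^-1) y x.
Proof.
move=> [Hc cE]; split=> [k|i k]; first exact: HV.
by apply: (canLR (mulKg _)); rewrite mulgA cE mulgK.
Qed.

Lemma gauge_conj h x : H h ->
  gauge (fun=> h) x [tuple h^-1 * tnth x i * h | i < n].
Proof. by move=> Hh; split=> // i k; rewrite tnth_mktuple -mulgA mulVKg. Qed.

Definition gauge_equiv x y : Prop := exists c, gauge c x y.

Lemma gauge_equivP : equiv_rel gauge_equiv.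
Proof.
split=> [x|x y [c cxy]|x y z [c cxy] [c' cyz]].
- by exists (fun=> 1); apply: gauge_id.
- by exists (fun k => (c k)^-1); apply: gauge_inv.
- by exists (fun k => c k * c' k); apply: gauge_comp cyz.
Qed.

(** The solution of c_(k+1) = a_k c_k with c_0 = 1. As [Negz i] is -(i+1), it is a product of
    inverses for k < 0. *)
Definition partial_prod a k : G :=
  match k with
  | Posz m => iteri m (fun i g => a i * g) 1
  | Negz m => iteri m.+1 (fun i g => (a (Negz i))^-1 * g) 1
  end.

Lemma partial_prodS a k : partial_prod a (k + 1)%R = a k * partial_prod a k.
Proof.
case: k => [m|[|m]]; first by rewrite -PoszD addn1.
  by rewrite /= mulg1 mulgV.
have -> : (Negz m.+1 + 1 = Negz m)%R.
  by rewrite !NegzE -[m.+2]addn1 PoszD opprD subrK.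
by rewrite /= mulVKg.
Qed.

(** The target is forced by the gauge equation at k = 0; since [a] leads from [x] to itself, the
    equations at k and k+1 are equivalent. *)
Lemma gauge_partial_prod a x : gauge a x x ->
  gauge (partial_prod a) x [tuple tnth x i * partial_prod a (f i) | i < n].
Proof.
move=> [Ha aE]; split=> [|i].
  apply: int_shift_ind => // k; rewrite partial_prodS; split=> [|Hak].
    exact: HM.
  by rewrite -(mulKg (a k) (partial_prod a k)); apply: HM => //; apply: HV.
apply: int_shift_ind => [|k]; first by rewrite mul1g tnth_mktuple add0r.
rewrite (addrAC k) !partial_prodS (mulgA _ (a _)) -aE -!(mulgA (a k)).
by split=> [->|/mulgI].
Qed.

(* Inverts gauge_partial_prod. *)
Lemma gauge_ratio c x y : c 0%R = 1 -> gauge c x y ->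
  gauge (fun k => c (k + 1)%R * (c k)^-1) x x.
Proof.
move=> c0 [Hc cE]; split=> [k|i k]; first by apply: HM => //; apply: HV.
rewrite mulgA addrAC -cE -[LHS]mulgA -[RHS]mulgA; congr (_ * _).
by apply: (canRL (mulgK _)); rewrite -mulgA -cE mulKg.
Qed.

Lemma partial_prod_ratio c : c 0%R = 1 ->
  forall k, partial_prod (fun k => c (k + 1)%R * (c k)^-1) k = c k.
Proof.
move=> c0; apply: int_shift_ind => [|k]; first by rewrite c0.
rewrite partial_prodS -mulgA; split=> [->|]; first by rewrite mulVg mulg1.
move/(canRL (mulKg _)); rewrite mulVg => /(canRL (mulVKg _)).
by rewrite mulg1.
Qed.

Variable b : 'I_n -> int.
Hypothesis bf : (\sum_i b i * f i = 1)%R.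

(** The gauge equation ties c_k to c_(k + f_i), so agreement propagates in both directions. *)
Lemma gauge_eq c c' x y : gauge c x y -> gauge c' x y ->
  c 0%R = c' 0%R -> c =1 c'.
Proof.
move=> [_ cE] [_ c'E] eq0; apply: (int_lin_comb_ind bf) => // i k.
split=> [eqk|]; first by apply: (mulgI (tnth x i)); rewrite -cE -c'E eqk.
by move=> eqk; apply: (mulIg (tnth y i)); rewrite cE c'E eqk.
Qed.

Lemma card_divides_gauge (S : set (n.-tuple G)) :
  (forall x y, gauge_equiv x y -> S x -> S y) -> card_divides H S.
Proof.
move=> SR; pose stab x g := exists2 a, gauge a x x & a 0%R = g.
(* This is the relation of lying in the same coset C h, where [stab x] is the subgroup C. *)
have coset_equiv x : equiv_rel (fun g h => stab x (g * h^-1)).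
  split=> [g|g h [a axx a0]|g h k [a axx a0] [a' a'xx a'0]].
  - by exists (fun=> 1); [apply: gauge_id | rewrite mulgV].
  - exists (fun k => (a k)^-1); first exact: gauge_inv.
    by rewrite a0 invgM invgK.
  - exists (fun k => a k * a' k); first exact: gauge_comp a'xx.
    by rewrite a0 a'0 mulgA mulgVK.
have [rep repP] := choice (fun x => equiv_rel_repr (coset_equiv x)).
have loop_ex (p : n.-tuple G * G) : exists c : int -> G,
    gauge c p.1 p.1 /\ c 0%R = p.2 * (rep p.1 p.2)^-1.
  by have [a axx a0] := (repP p.1).1 p.2; exists a.
have [loop loopP] := choice loop_ex.
pose F x h := [tuple (rep x h)^-1 *
  tnth [tuple tnth x i * partial_prod (loop (x, h)) (f i) | i < n] i
  * rep x h | i < n].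
have repH x h : H h -> H (rep x h).
  move=> Hh; have [[Hl _] l0] := loopP (x, h).
  rewrite -[rep x h]invgK; apply: HV.
  rewrite -(mulKg h (rep x h)^-1); apply: HM; first exact: HV.
  by rewrite -[h * _]l0.
have F_gauge x h : H h ->
    gauge (fun k => partial_prod (loop (x, h)) k * rep x h) x (F x h).
  move=> Hh; apply: (gauge_comp (gauge_partial_prod (loopP (x, h)).1)).
  exact/gauge_conj/repH.
apply: (card_divides_equiv (F := F) gauge_equivP SR) => x.
  move=> h h' /set_mem Hh /set_mem Hh' eqF.
  have g := F_gauge x h Hh; have g' := F_gauge x h' Hh'; rewrite -eqF in g'.
  (* Both families share source and target, so their quotient is a loop at [x]; its value at 0 puts
     both representatives in the same coset. *)
  have eq_rep : rep x h = rep x h'.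
    have [rep_ext rep_eq] := repP x.
    have rep_id u : rep x (rep x u) = rep x u by apply/esym/rep_eq/rep_ext.
    rewrite -[LHS]rep_id -[RHS]rep_id; apply: rep_eq.
    exists (fun k => partial_prod (loop (x, h)) k * rep x h *
      (partial_prod (loop (x, h')) k * rep x h')^-1).
      exact/(gauge_comp g)/gauge_inv.
    by rewrite /= !mul1g.
  (* Both families now agree at 0, hence at 1, where the partial products are the values h r^-1 and
     h' r^-1 of the loops at 0. *)
  rewrite -eq_rep in g'; have := gauge_eq g g'; rewrite /= !mul1g.
  move=> /(_ erefl 1%R) /mulIg; rewrite -[1%R]add0r !partial_prodS /= !mulg1.
  by rewrite (loopP (x, h)).2 (loopP (x, h')).2 /= -eq_rep => /mulIg.
apply/seteqP; split=> [_ [h Hh <-]|y [c cxy]].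
  by exists (fun k => partial_prod (loop (x, h)) k * rep x h); apply: F_gauge.
have [rep_ext rep_eq] := repP x.
pose r := rep x (c 0%R).
have Hr : H r by apply/repH/(proj1 cxy).
have [a axx a0] := rep_ext (c 0%R).
(* Normalise [c] to have value 1 at 0: undo the loop [a], whose value at 0 is c_0 r^-1, then
   multiply by r^-1, which conjugates the target. *)
pose c' k := (a k)^-1 * c k * r^-1.
pose y' := [tuple r^-1^-1 * tnth y i * r^-1 | i < n].
have c'0 : c' 0%R = 1 by rewrite /c' a0 -/r invgM invgK mulgVK mulgV.
have c'y' : gauge c' x y'.
  exact: (gauge_comp (gauge_comp (gauge_inv axx) cxy) (gauge_conj y (HV Hr))).
have ratio := gauge_ratio c'0 c'y'.
(* This choice is forced: the loop of ratios of c' has value c'_1 at 0, which has to be h r^-1. *)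
pose h := c' 1%R * r.
have Hh : H h by apply: HM => //; apply: (proj1 c'y').
have rep_h : rep x h = r.
  rewrite /r (rep_eq _ _ (rep_ext (c 0%R))); apply: rep_eq.
  exists (fun k => c' (k + 1)%R * (c' k)^-1) => //.
  by rewrite add0r c'0 invg1 mulg1 /h -/r mulgK.
exists h => //.
have loop_eq : loop (x, h) = (fun k => c' (k + 1)%R * (c' k)^-1).
  apply: funext; apply: gauge_eq (loopP (x, h)).1 ratio _.
  by rewrite (loopP (x, h)).2 /= rep_h /h mulgK add0r c'0 invg1 mulg1.
apply: eq_from_tnth => i; rewrite !tnth_mktuple loop_eq partial_prod_ratio //.
have [_ /(_ i 0%R)] := c'y'; rewrite c'0 mul1g add0r tnth_mktuple invgK => <-.
by rewrite rep_h mulgA mulKg mulgVK.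
Qed.

End Gauge.

Local Open Scope ring_scope.

(** * Integer kernel vectors with coprime entries, and weights *)

(** In the Smith normal form A = L D R the small rank forces a zero column j of D. Take column j of
    R^-1 for [f] and row j of R for [b]; [b] certifies that the entries of [f] are coprime. *)
Lemma primitive_kernel_vector m n (A : 'M[int]_(m, n)) :
  (\rank (map_mx (fun a : int => a%:~R : rat) A) < n)%N ->
  exists (f : 'cV[int]_n) (b : 'rV[int]_n), A *m f = 0 /\ b *m f = 1%:M.
Proof.
have [L Lu [R Ru [s _ ->]]] := int_Smith_normal_form A.
set D := (\matrix_(i, j) _)%R => rk.
have [j Dj] : exists j, col j D = 0.
  apply: contrapT => /forallNP Dn0; move: rk; rewrite ltnNge => /negP; apply.
  have sj (j : 'I_n) : s`_j != 0 /\ (j < m)%N.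
    split.
      apply/negP => /eqP sj0; apply: (Dn0 j); apply/colP => i.
      by rewrite !mxE; case: eqP => [->|]; rewrite ?sj0.
    rewrite ltnNge; apply/negP => lemj; apply: (Dn0 j); apply/colP => i.
    rewrite !mxE; case: eqP => // eij.
    by have := ltn_ord i; rewrite eij ltnNge lemj.
  (* If no column vanishes, the diagonal of D has n nonzero entries, so D, and hence A, has a
     rational left inverse. *)
  pose D' : 'M[rat]_(n, m) := \matrix_(j, i) ((s`_j)%:~R^-1 *+ (j == i :> nat)).
  have D'D : D' *m map_mx intr D = 1%:M.
    apply/matrixP => j j'; rewrite !mxE.
    rewrite (bigD1 (Ordinal (sj j).2)) //= big1 => [|i].
      rewrite !mxE /= eqxx mulr1n addr0 val_eqE; case: eqP => [_|_].
        by rewrite mulVf // intr_eq0 (sj j).1.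
      by rewrite mulr0.
    by rewrite -val_eqE /= => /negPf ij; rewrite !mxE (eq_sym (j : nat)) ij mul0r.
  have left_inv : map_mx intr (invmx R) *m D' *m map_mx intr (invmx L)
      *m map_mx (intr : int -> rat) (L *m D *m R) = 1%:M.
    rewrite -mulmxA -map_mxM !mulmxA mulVmx // mul1mx map_mxM mulmxA.
    rewrite -(mulmxA _ D') D'D mulmx1 -map_mxM mulVmx //.
    by rewrite map_mx1.
  by have := mxrankM_maxr (map_mx intr (invmx R) *m D' *m map_mx intr (invmx L))
    (map_mx (intr : int -> rat) (L *m D *m R)); rewrite left_inv mxrank1.
exists (invmx R *m delta_mx j 0), (delta_mx 0 j *m R); split.
  by rewrite -!mulmxA mulKVmx // -colE Dj mulmx0.
rewrite mulmxA -(mulmxA _ R) mulmxV // mulmx1 mul_delta_mx.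
by apply/matrixP => i i'; rewrite !mxE !ord1.
Qed.

Definition linear_weight n (f : 'cV[int]_n) (a : 'rV[int]_n) : int := (a *m f) 0 0.

Section Weight.
Variables (n : nat) (f : 'cV[int]_n).

Lemma linear_weight_is_additive : additive (linear_weight f).
Proof. by move=> a b; rewrite /linear_weight mulmxBl !mxE. Qed.

HB.instance Definition _ :=
  GRing.isAdditive.Build 'rV[int]_n int (linear_weight f) linear_weight_is_additive.

Lemma linear_weightZ k a : linear_weight f (k *: a) = k * linear_weight f a.
Proof. by rewrite /linear_weight -scalemxAl mxE. Qed.

Lemma linear_weight_delta i : linear_weight f (delta_mx 0 i) = f i 0.
Proof. by rewrite /linear_weight -rowE mxE. Qed.
End Weight.

(** * Potentials on the vertices of a graph *)

Section Potential.
Variables (n : nat) (E : seq (edge n)) (f : 'cV[int]_n).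
Implicit Types z : 'rV[int]_(size E).

Definition edge_weights : 'cV[int]_(size E) :=
  \col_i linear_weight f (elab (nth_edge i)).

Definition boundary z (y : nat) : int :=
  \sum_(i | etgt (nth_edge i) == y) z 0 i
  - \sum_(i | esrc (nth_edge i) == y) z 0 i.

Lemma boundaryD z z' y : boundary (z + z') y = boundary z y + boundary z' y.
Proof.
rewrite /boundary addrACA -opprD -!big_split /=.
by congr (_ - _); apply: eq_bigr => i _; rewrite mxE.
Qed.

Lemma boundaryN z y : boundary (- z) y = - boundary z y.
Proof.
have sumN P : \sum_(i | P i) (- z) 0 i = - \sum_(i | P i) z 0 i.
  by rewrite -sumrN; apply: eq_bigr => i _; rewrite mxE.
by rewrite /boundary !sumN opprD.
Qed.

Lemma boundary_delta i y :
  boundary (delta_mx 0 i) y = (etgt (nth_edge i) == y)%:R - (esrc (nth_edge i) == y)%:R.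
Proof.
have sum_delta (P : pred 'I_(size E)) :
    \sum_(j | P j) (delta_mx 0 i : 'rV[int]_(size E)) 0 j = (P i)%:R.
  rewrite big_mkcond (bigD1 i) //= big1 ?addr0 => [|j ji]; last first.
    by rewrite mxE (negPf ji) andbF; case: (P j).
  by rewrite mxE !eqxx; case: (P i).
by rewrite /boundary !sum_delta.
Qed.

Lemma in_H1_boundary z : boundary z =1 (fun=> 0) -> in_H1 z.
Proof. by move=> bz y; apply/eqP; rewrite -subr_eq0 -[_ - _]/(boundary z y) bz. Qed.

(** Choose a root in each component and let d(y) be minus the weight of a chain from y to its root.
    An edge and the chains of its two ends combine to an element of H_1, of weight 0. *)
Lemma potential_of_H1 :
  (forall z, in_H1 z -> linear_weight edge_weights z = 0) ->
  exists d : nat -> int, forall e, e \in E ->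
    d (etgt e) = d (esrc e) + linear_weight f (elab e).
Proof.
move=> H0.
(* Here [z] is a 1-chain leading from [y] to [y'], not necessarily a walk. *)
pose conn (y y' : nat) z := forall u, boundary z u = (y' == u)%:R - (y == u)%:R.
have conn_equiv : equiv_rel (fun y y' => exists z, conn y y' z).
  split=> [y|y y' [z zE]|y1 y2 y3 [z zE] [z' z'E]].
  - exists 0 => u; rewrite subrr; apply: (addrI (boundary 0 u)).
    by rewrite -boundaryD !addr0.
  - by exists (- z) => u; rewrite boundaryN zE opprB.
  - by exists (z + z') => u; rewrite boundaryD zE z'E addrC addrA subrK.
have [rep [repP rep_eq]] := equiv_rel_repr conn_equiv.
have [path pathP] := choice repP.
exists (fun y => - linear_weight edge_weights (path y)) => e.
move=> /(nthP (0%N, 0%N, 0)) [m lt_m <-].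
pose i : 'I_(size E) := Ordinal lt_m.
have <- : nth_edge i = nth (0%N, 0%N, 0) E m by rewrite /nth_edge (tnth_nth (0%N, 0%N, 0)).
have eq_rep : rep (esrc (nth_edge i)) = rep (etgt (nth_edge i)).
  by apply: rep_eq; exists (delta_mx 0 i) => u; rewrite boundary_delta.
have : linear_weight edge_weights
    (delta_mx 0 i + path (etgt (nth_edge i)) - path (esrc (nth_edge i))) = 0.
  apply/H0/in_H1_boundary => u.
  by rewrite !boundaryD boundaryN boundary_delta !pathP eq_rep; ring.
rewrite raddfB raddfD /= linear_weight_delta mxE => /subr0_eq <-.
by rewrite opprD addrAC addNr add0r.
Qed.

Lemma linear_weight_chain (c : seq (dart E)) :
  linear_weight edge_weights (chain c) = linear_weight f (label_sum c).
Proof.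
rewrite /chain /label_sum !raddf_sum; apply: eq_bigr => e _.
by rewrite /= !linear_weightZ linear_weight_delta mxE.
Qed.

Lemma potential_of_cycles (cs : seq (seq (dart E))) :
  generating_cycles cs ->
  (forall c, c \in cs -> linear_weight f (label_sum c) = 0) ->
  exists d : nat -> int, forall e, e \in E ->
    d (etgt e) = d (esrc e) + linear_weight f (elab e).
Proof.
move=> [_ span] cs0; apply: potential_of_H1 => z /span [a ->].
rewrite raddf_sum big1 // => i _; rewrite raddfMz.
have lti : (i < size cs)%N by case: i => i /=; rewrite size_map.
by rewrite /= (nth_map [::]) // linear_weight_chain cs0 ?mem_nth // mul0rz.
Qed.

End Potential.

(** * Evaluation of words and formulas *)

Section Evaluation.
Local Open Scope group_scope.
Variables (G : groupType) (n : nat).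
Implicit Types (v : var n -> G) (w : word G n).

Definition eval_letter v (l : letter G n) : G :=
  match l with Lcst g => g | Lvar x e => if e then (v x)^-1 else v x end.

Definition eval_word v w : G := foldr (fun l a => eval_letter v l * a) 1 w.

Lemma eval_word_cat v w w' :
  eval_word v (w ++ w') = eval_word v w * eval_word v w'.
Proof. by elim: w => [|l w IH] /=; rewrite ?mul1g // IH mulgA. Qed.

Lemma eval_inv_word v w : eval_word v (inv_word w) = (eval_word v w)^-1.
Proof.
elim: w => [|l w IH]; first by rewrite invg1.
rewrite /inv_word /= rev_cons -cats1 eval_word_cat -/(inv_word w) IH invgM /= mulg1.
by case: l => [g|x [|]] //=; rewrite invgK.
Qed.

Lemma eval_term_word v t : eval_word v (term_word t) = eval v t.
Proof.
elim: t => [g|x|s IHs t IHt|t IHt] /=; rewrite ?mulg1 //.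
  by rewrite eval_word_cat IHs IHt.
by rewrite eval_inv_word IHt.
Qed.

Lemma eval_free_prod_eq v w w' :
  free_prod_eq w w' -> eval_word v w = eval_word v w'.
Proof.
elim=> [//|//|u u' u'' _ -> _ -> //|p s g h|p s|p s x e].
- by rewrite !eval_word_cat /= !mulg1 mulgA.
- by rewrite !eval_word_cat /= !mulg1 mul1g.
- rewrite !eval_word_cat /= mulg1.
  by case: e; rewrite /= ?mulVg ?mulgV mul1g.
Qed.

Lemma mulg_eq1C (g h : G) : g * h = 1 <-> h * g = 1.
Proof. by split=> /(canRL (mulgK _)) ->; rewrite mul1g ?mulgV ?mulVg. Qed.

(** A cyclic shift conjugates the value of a word, and the only conjugate of 1 is 1. *)
Lemma eval_can_be_written v u w :
  can_be_written u w -> eval_word v u = 1 <-> eval_word v w = 1.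
Proof.
move=> [p [q [/(eval_free_prod_eq v) -> ->]]].
by rewrite !eval_word_cat; apply: mulg_eq1C.
Qed.

Lemma holds_eq_on (phi : formula G n) v v' :
  {in unquantified phi, v =1 v'} -> holds v phi <-> holds v' phi.
Proof.
have eval_eq (t : term G n) u u' : {in term_vars t, u =1 u'} -> eval u t = eval u' t.
  elim: t => [g|x|s IHs t IHt|t IHt] //= eqv.
  - by apply: eqv; rewrite mem_head.
  - by rewrite IHs ?IHt // => x xt; apply: eqv; rewrite mem_cat xt ?orbT.
  - by rewrite IHt.
have catl (s1 s2 : seq ('I_n + nat)) u u' :
    {in s1 ++ s2, u =1 u' :> (_ -> G)} -> {in s1, u =1 u'} /\ {in s2, u =1 u'}.
  by move=> eqv; split=> x xs; apply: eqv; rewrite mem_cat xs ?orbT.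
have upd p y u u' g : {in [seq x <- unquantified p | x != inr y], u =1 u'} ->
    {in unquantified p, update u y g =1 update u' y g}.
  move=> eqv x xp; rewrite /update; case: eqP => // /eqP xy.
  by apply: eqv; rewrite mem_filter xy.
elim: phi v v' => [s t|p IH|p IHp q IHq|p IHp q IHq|p IHp q IHq|y p IH|y p IH] v v' /=.
- by move/catl => [/eval_eq -> /eval_eq ->].
- by move/IH => E; split=> nE /E.
- by move/catl => [/IHp Ep /IHq Eq]; rewrite Ep Eq.
- by move/catl => [/IHp Ep /IHq Eq]; rewrite Ep Eq.
- by move/catl => [/IHp Ep /IHq Eq]; rewrite Ep Eq.
- by move=> /upd eqv; split=> hp g; apply/(IH _ _ (eqv g)).
- by move=> /upd eqv; split=> -[g hp]; exists g; apply/(IH _ _ (eqv g)).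
Qed.

(** Induction on the formula, which may have any shape: [R] survives every quantifier because each
    value on one side is matched on the other, so only atoms remain to be compared. *)
Lemma holds_back_and_forth (R : (var n -> G) -> (var n -> G) -> Prop) (phi : formula G n) :
  (forall v v' y g, R v v' -> exists g', R (update v y g) (update v' y g')) ->
  (forall v v' y g', R v v' -> exists g, R (update v y g) (update v' y g')) ->
  (forall v v' u, R v v' -> List.In u (atoms phi) ->
     eval_word v u = 1 <-> eval_word v' u = 1) ->
  forall v v', R v v' -> holds v phi <-> holds v' phi.
Proof.
move=> forth back.
pose ok (us : seq (word G n)) := forall v v' u, R v v' -> List.In u us ->
  eval_word v u = 1 <-> eval_word v' u = 1.
pose same p := forall v v', R v v' -> holds v p <-> holds v' p.
have both p q : (ok (atoms p) -> same p) -> (ok (atoms q) -> same q) ->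
    ok (atoms p ++ atoms q) -> same p /\ same q.
  move=> Hp Hq okpq; split.
    by apply: Hp => v v' u vv' uP; apply: okpq vv' (List.in_or_app _ _ _ (or_introl uP)).
  by apply: Hq => v v' u vv' uP; apply: okpq vv' (List.in_or_app _ _ _ (or_intror uP)).
elim: phi => [s t|p IH|p IHp q IHq|p IHp q IHq|p IHp q IHq|y p IH|y p IH] /= atomP v v' vv'.
- have := atomP _ _ _ vv' (or_introl erefl).
  rewrite !eval_word_cat !eval_inv_word !eval_term_word => E.
  have eq1 (g h : G) : g = h <-> g * h^-1 = 1.
    by split=> [->|/(canRL (mulgVK _))]; rewrite ?mulgV ?mul1g.
  by rewrite eq1 E -eq1.
- by have E := IH atomP _ _ vv'; split=> nE /E.
- by have [Ep Eq] := both _ _ IHp IHq atomP; rewrite (Ep _ _ vv') (Eq _ _ vv').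
- by have [Ep Eq] := both _ _ IHp IHq atomP; rewrite (Ep _ _ vv') (Eq _ _ vv').
- by have [Ep Eq] := both _ _ IHp IHq atomP; rewrite (Ep _ _ vv') (Eq _ _ vv').
- split=> hp g.
    by have [g' r] := back _ _ y g vv'; apply/(IH atomP _ _ r).
  by have [g' r] := forth _ _ y g vv'; apply/(IH atomP _ _ r).
- split=> -[g hp].
    by have [g' r] := forth _ _ y g vv'; exists g'; apply/(IH atomP _ _ r).
  by have [g' r] := back _ _ y g vv'; exists g'; apply/(IH atomP _ _ r).
Qed.

End Evaluation.

(** * Splitting words into syllables *)

Section Syllables.
Variables (G : groupType) (n : nat) (ws : seq (word G n)).

Definition plain (l : letter G n) : Prop :=
  match l with
  | Lcst g => non_isolated ws g
  | Lvar (inl _) _ => True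
  | Lvar (inr _) _ => False
  end.

(** For isolating t the subword t^-1 g t is kept in one piece, because g need not commute with the
    gauge. *)
Inductive syllabic : word G n -> Prop :=
| syl_nil : syllabic [::]
| syl_plain l w : plain l -> syllabic w -> syllabic (l :: w)
| syl_bound y e w : ~ isolating ws y -> syllabic w ->
    syllabic (Lvar (inr y) e :: w)
| syl_isolating t g w : isolating ws t -> syllabic w ->
    syllabic [:: Lvar (inr t) true, Lcst g, Lvar (inr t) false & w].

(* The reversed word r does not end inside a subword t^-1 g t with t isolating. *)
Let complete (r : word G n) : Prop :=
  match r with
  | Lvar (inr t) true :: _ | Lcst _ :: Lvar (inr t) true :: _ => ~ isolating ws t
  | _ => True
  end.

(** In a reading from the left, [r] is the reversed part already read. As [r] is complete, the next
    letter is neither an isolated coefficient nor t for an isolating t: either would continue an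
    unfinished t^-1 g t. *)
Lemma syllabic_word w : List.In w ws -> syllabic w.
Proof.
move=> wws.
(* The bound [m] on the length serves the isolating case, which consumes three letters. *)
suff H m (r s : word G n) : (size s <= m)%N -> w = catrev r s -> complete r -> syllabic s.
  exact: (H (size w) [::] w).
elim: m r s => [|m IH] r [|[g|[i|y] e] s] //=; rewrite ?ltnS => les Dw rP; try exact: syl_nil.
- apply: syl_plain; last first.
    apply: IH (Lcst g :: r) _ les Dw _ => /=.
    by case: r rP => [|[//|[//|t] [|]] r].
  rewrite catrevE in Dw; split; first by exists w, (rev r), s.
  move=> [_ iso]; have [t [p [s' [isot Er _]]]] := iso _ _ _ wws Dw.
  have {Er} Er : r = Lvar (inr t) true :: rev p by rewrite -[r]revK Er rev_cat.
  by rewrite Er in rP.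
- by apply: syl_plain => //; apply: IH (Lvar (inl i) e :: r) _ les Dw _.
case: (pselect (isolating ws y)) => isoy; last first.
  by apply: syl_bound => //; apply: IH (Lvar (inr y) e :: r) _ les Dw _; case: e.
have Dw' := Dw; rewrite catrevE in Dw'.
case: e Dw Dw' => Dw Dw'.
  have [g [s' Es]] := (isoy _ _ _ wws).1 Dw'.
  rewrite {}Es in Dw Dw' les *; apply: syl_isolating => //.
  apply: IH ([:: Lvar (inr y) false, Lcst g, Lvar (inr y) true & r]) _ _ _ _ => //.
  by apply: leq_trans les; rewrite /= leqW.
have [g [p' Er]] := (isoy _ _ _ wws).2 Dw'.
have {Er} Er : r = [:: Lcst g, Lvar (inr y) true & rev p'].
  by rewrite -[r]revK Er rev_cat.
by rewrite Er in rP.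
Qed.

End Syllables.

(** * Levels along words *)

Section Levels.
Variables (G : groupType) (n : nat) (f : 'cV[int]_n) (d : nat -> int).
Implicit Types (w : word G n) (k : int).

Definition letter_weight (l : letter G n) : int :=
  linear_weight f (letter_exponents l).

(* Reading w from level k leads to level k', where a letter of nonzero
   exponents raises the level by its weight and a bound variable y is read at
   level d y. *)
Fixpoint levels k k' w : Prop :=
  match w with
  | [::] => k = k'
  | Lvar (inr y) _ :: w' => k = d y /\ levels (d y) k' w'
  | l :: w' => levels (k + letter_weight l) k' w'
  end.

Lemma levels_cat k1 k2 w w' :
  levels k1 k2 (w ++ w') <-> exists2 k, levels k1 k w & levels k k2 w'.
Proof.
elim: w k1 => [|[g|[i|y] e] w IH] k1 //=.
- by split=> [H|[k ->]//]; exists k1.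
- split=> [[Ek /IH [k]]|[k [Ek H] H']]; first by exists k.
  by split=> //; apply/IH; exists k.
Qed.

Lemma levels_plain k k' w : ~~ has (@is_bound G n) w ->
  levels k k' w <-> k + linear_weight f (exponents w) = k'.
Proof.
rewrite /exponents; elim: w k => [|l w IH] k.
  by rewrite big_nil raddf0 addr0.
rewrite /= negb_or => /andP[nl nw]; rewrite big_cons raddfD addrA -IH //.
by case: l nl => [g|[i|y] e].
Qed.

(** The current level is d(cur) plus the weight of [a]; each edge makes it equal to d at the next
    bound variable, and the last edge closes the cycle. *)
Lemma levels_edges_from first cur a w :
  (forall e, e \in edges_from first cur a w ->
     d (etgt e) = d (esrc e) + linear_weight f (elab e)) ->
  levels (d cur + linear_weight f a) (d first) w.
Proof.
have step (l : letter G n) x : d cur + linear_weight f x + letter_weight l =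
    d cur + linear_weight f (x + letter_exponents l) by rewrite raddfD addrA.
elim: w cur a step => [|[g|[i|y] e] w IH] cur a step /= dP.
- by rewrite (dP (cur, first, a)) ?mem_head.
- by rewrite step; apply: IH.
- by rewrite step; apply: IH.
split; first by rewrite (dP (cur, y, a)) ?mem_head.
have := IH y 0; rewrite raddf0 addr0; apply=> [l x|e' e'P].
  by rewrite raddfD addrA.
by apply: dP; rewrite in_cons e'P orbT.
Qed.

(** Reading cyclically from the first bound variable y leads from d(y) back to d(y); k is the level
    at which the end of [w] is passed. *)
Lemma levels_word w :
  (forall e, e \in word_edges w ->
     d (etgt e) = d (esrc e) + linear_weight f (elab e)) ->
  (~~ has (@is_bound G n) w -> linear_weight f (exponents w) = 0) ->
  exists k, levels k k w.
Proof.
move=> dP w0; have [hasw|/negP hasw] := boolP (has (@is_bound G n) w); last first.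
  by exists 0; apply/levels_plain; [apply/negP | rewrite add0r w0 //; apply/negP].
move: hasw dP {w0}; case/split_find => l p s bl np.
rewrite /word_edges cat_rcons find_cat (negPf np) /= bl addn0 rot_size_cat.
case: l bl => [|[|y] e] //= _ /levels_edges_from.
rewrite raddf0 addr0 => /levels_cat [k sk /levels_plain pk].
exists k; apply/levels_cat; exists (d y); last by [].
by apply/levels_plain => //; apply: pk.
Qed.

End Levels.

(** * Transfer of solutions along a gauge transformation *)

Section Transfer.
Local Open Scope group_scope.
Variables (G : groupType) (n : nat) (phi : formula G n) (ws : seq (word G n)).
Hypotheses (hfree : has_free_vars phi) (hws : writing phi ws).
Variables (f : 'cV[int]_n) (d : nat -> int).
Hypothesis levelsP : forall w, List.In w ws -> exists k, levels f d k k w.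
Variables (c : int -> G) (x x' : n.-tuple G).
Hypothesis cxx' : gauge (centraliser (non_isolated ws)) (fun i => f i 0%R) c x x'.

(* For y isolating, y^-1 g y is conjugated by c (d y) even when c (d y) does not
   commute with the coefficient g. *)
Definition bound_transfer (y : nat) (g : G) : G :=
  if `[< isolating ws y >] then g * c (d y) else (c (d y))^-1 * g * c (d y).

Definition valuation_transfer (v v' : var n -> G) : Prop :=
  [/\ forall i, v (inl i) = tnth x i, forall i, v' (inl i) = tnth x' i
    & forall y, v' (inr y) = bound_transfer y (v (inr y))].

Lemma eval_plain_letter v v' l k : valuation_transfer v v' -> plain ws l ->
  c k * eval_letter v' l = eval_letter v l * c (k + letter_weight f l)%R.
Proof.
have [cH cE] := cxx'; move=> [vx v'x' _]; case: l => [g|[i|y] e] //=.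
  move=> Kg; rewrite /letter_weight raddf0 addr0.
  exact: cH.
move=> _; rewrite /letter_weight /= linear_weightZ linear_weight_delta vx v'x'.
case: e; last by rewrite expr0 mul1r cE.
rewrite expr1 mulN1r; apply: (canLR (mulgK _)); rewrite -mulgA.
by rewrite cE subrK mulKg.
Qed.

(** The factors c telescope: each syllable carries the c of its initial level to that of its final
    level. For k = k' the value is conjugated by c_k. *)
Lemma eval_syllabic v v' w k k' : valuation_transfer v v' -> syllabic ws w ->
  levels f d k k' w -> c k * eval_word v' w = eval_word v w * c k'.
Proof.
move=> vv' sw; elim: sw k => {w} [|l w pl _ IH|y e w niso _ IH|t g w iso _ IH] k /=.
- by move=> ->; rewrite mulg1 mul1g.
- move=> lev; rewrite mulgA (eval_plain_letter _ vv' pl) -!mulgA; congr (_ * _).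
  by apply: IH; case: l pl lev => [|[|y] e].
- move=> [-> lev]; rewrite -[RHS]mulgA -(IH _ lev) !mulgA; congr (_ * _).
  have [_ _ ->] := vv'; rewrite /bound_transfer asboolF //.
  by case: e; rewrite ?invgM ?invgK -?mulgA ?mulKg ?mulVKg ?mulVg ?mulg1 // !mulgA mulgV mul1g.
- move=> [-> [_ lev]]; have [_ _ ->] := vv'; rewrite /bound_transfer asboolT //.
  by rewrite -!mulgA -(IH _ lev) invgM -!mulgA mulVKg.
Qed.

Lemma solutions_gauge : solutions phi x -> solutions phi x'.
Proof.
(* This is the transfer of [valuation x]. It can differ from [valuation x'] only on bound variables,
   which have no unquantified occurrence. *)
pose v0' (z : var n) :=
  match z with inl i => tnth x' i | inr y => bound_transfer y 1 end.
have eqv : {in unquantified phi, v0' =1 valuation x'} by move=> [i|y] //; rewrite hfree.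
have vv' : valuation_transfer (valuation x) v0' by [].
rewrite /solutions /= => hx; apply/(holds_eq_on eqv).
suff: holds (valuation x) phi <-> holds v0' phi by case=> + _; apply.
apply: (holds_back_and_forth (R := valuation_transfer)) vv' => //.
- move=> v v' y g [vx v'x' vv']; exists (bound_transfer y g); split=> // z.
  by rewrite /update !(inj_eq inr_inj); case: eqP => [->|].
- move=> v v' y g [vx v'x' vv'].
  (* The witness is the preimage of the given value under [bound_transfer y]. *)
  exists (if `[< isolating ws y >] then g * (c (d y))^-1 else c (d y) * g * (c (d y))^-1).
  split=> // z; rewrite /update; case: eqP => [[->]|//].
  by rewrite /bound_transfer; case: asboolP => _; rewrite ?mulgVK // -!mulgA mulKg mulVg mulg1.
move=> v v' u vv' uP.
have [w wws uw] : exists2 w, List.In w ws & can_be_written u w.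
  elim: hws uP => //= u' w us ws' uw _ IH [<-|/IH[w' ? ?]].
    by exists w => //; left.
  by exists w' => //; right.
have [k kw] := levelsP wws.
have := eval_syllabic vv' (syllabic_word wws) kw.
rewrite !(eval_can_be_written _ uw) => E; split=> w1.
  by apply: (mulgI (c k)); rewrite E w1 mul1g mulg1.
by apply: (mulIg (c k)); rewrite -E w1 mul1g mulg1.
Qed.

End Transfer.

(** * Rows of A(phi) and conclusion *)

Lemma linear_weight_rowsA G n (ws : seq (word G n))
    (cs : seq (seq (dart (digraph ws)))) (f : 'cV[int]_n) :
  matrixA cs *m f = 0 -> forall r, r \in rowsA cs -> linear_weight f r = 0.
Proof.
move=> Af r /(tnthP (in_tuple (rowsA cs))) [i ->].
have -> : tnth (in_tuple (rowsA cs)) i = row i (matrixA cs) by rewrite rowK.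
by rewrite /linear_weight -row_mul Af !mxE.
Qed.

Lemma digraph_word_edges G n (ws : seq (word G n)) (w : word G n) e :
  List.In w ws -> e \in word_edges w -> ~~ ((esrc e == etgt e) && (elab e == 0)) ->
  e \in digraph ws.
Proof.
rewrite /digraph mem_filter => + eE ->; elim: ws => //= w' ws IH [->|/IH eE'].
  by rewrite mem_cat eE.
by rewrite mem_cat eE' orbT.
Qed.

Lemma exponents_rowsA G n (ws : seq (word G n)) (cs : seq (seq (dart (digraph ws)))) w :
  List.In w ws -> ~~ has (@is_bound G n) w -> exponents w \in rowsA cs.
Proof.
rewrite mem_cat => + nw => wws; apply/orP; right.
elim: ws {cs} wws => //= w' ws IH [->|/IH]; first by rewrite nw mem_head.
by case: ifP => // _ H; rewrite in_cons H orbT.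
Qed.

Theorem mainTheorem1 (G : groupType) (n : nat) (phi : formula G n)
    (hfree : has_free_vars phi)
    (ws : seq (word G n)) (hws : writing phi ws)
    (cs : seq (seq (dart (digraph ws)))) (hcs : generating_cycles cs)
    (hrank : (rankA cs < n)%N) :
  card_divides (centraliser (non_isolated ws)) (solutions phi) /\
  ((forall g : G, non_isolated ws g -> g = 1%g) ->
   card_divides [set: G]%classic (solutions phi)).
Proof.
have div : card_divides (centraliser (non_isolated ws)) (solutions phi).
  have [f [b [Af bf]]] := primitive_kernel_vector hrank.
  have row0 := linear_weight_rowsA Af.
  have cycle0 c : c \in cs -> linear_weight f (label_sum c) = 0.
    by move=> cP; apply: row0; rewrite mem_cat map_f.
  have [d dP] := potential_of_cycles hcs cycle0.
  have lev w : List.In w ws -> exists k, levels f d k k w.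
    move=> wws; apply: levels_word => [e eE|nw]; last exact/row0/exponents_rowsA.
    (* Loops with zero label are absent from the digraph but satisfy the potential equation
       trivially. *)
    have [/andP[/eqP <- /eqP ->]|ne] := boolP ((esrc e == etgt e) && (elab e == 0)).
      by rewrite raddf0 addr0.
    exact/dP/(digraph_word_edges wws).
  apply: (@card_divides_gauge _ _ _ (fun i => f i 0) _ _ _ (fun i => b 0 i)).
  - by move=> g _; rewrite mul1g mulg1.
  - by move=> g h Hg Hh k Kk; rewrite -mulgA (Hh k Kk) mulgA (Hg k Kk) mulgA.
  - move=> g Hg k Kk; apply: (canLR (mulKg _)); rewrite mulgA Hg //.
    by rewrite mulgK.
  - by have /matrixP/(_ 0 0) := bf; rewrite !mxE.
  - by move=> x y [c cxy]; apply: (solutions_gauge hfree hws lev cxy).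
split=> // K1; suff <- : centraliser (non_isolated ws) = [set: G]%classic by [].
by apply/seteqP; split=> // g _ k /K1 ->; rewrite mulg1 mul1g.
Qed.
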